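(* Let $r\ge 1$, let $b:\mathbb{R}^r\to\mathbb{R}^r$ have continuous and uniformly bounded derivatives of first and second order, and let $\sigma(x)=\Sigma\in\mathbb{R}^{r\times r}$ for all $x$ (homogeneous diffusion matrix, with $r=\overline{r}$, i.e. the Brownian motion has the same dimension as the state). Assume the log-norm of the Jacobian of $b$ is uniformly negative: $$-\lambda_b:=\sup_{x\in\mathbb{R}^r}\rho(\nabla b(x))<0 .$$ Let $B_t$ be an $r$-dimensional standard Brownian motion with $B_0=0$, let $\epsilon>0$, and let $\overline{B}_t$ be a piecewise smooth approximation of $B_t$ satisfying, for any $p\ge1$, the mean error estimate $$\sup_{t\ge 0}\mathbb{E}\left(\|B_t-\overline{B}_t\|^p\right)^{1/p}\le a_p\sqrt{\epsilon}$$ for some constants $a_p$. Let $X_t(x)$ and $\overline{X}_t(x)$ be the flows defined by $$dX_t(x)=b(X_t(x))\,dt+\Sigma\,dB_t,\qquad d\overline{X}_t(x)=b(\overline{X}_t(x))\,dt+\Sigma\,d\overline{B}_t,\qquad X_0(x)=\overline{X}_0(x)=x .$$ Then there exist $\lambda>0$ and a constant $c>0$ such that for any $t\ge 0$ one has the almost sure uniform estimate $$\|X_t-\overline{X}_t\|_\infty:=\sup_{x\in\mathbb{R}^r}\|X_t(x)-\overline{X}_t(x)\|\le c\left(\|B_t-\overline{B}_t\|+\left(\int_0^t e^{-2\lambda(t-s)}\,\|B_s-\overline{B}_s\|^2\,ds\right)^{1/2}\right).$$ In addition, the mean error estimate on $\overline{B}$ yields, for any $p\ge 1$, the space-time uniform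 estimate $$\sup_{t\ge 0}\mathbb{E}\left(\|X_t-\overline{X}_t\|_\infty^p\right)^{1/p}\le c_p\sqrt{\epsilon},$$ for some constant $c_p$ depending on $p$ but not on $\epsilon$.
   Context: For a square matrix $A$, $\rho(A):=\lambda_{\max}((A+A')/2)$ is the logarithmic norm, where $A'$ is the transpose and $\lambda_{\max}$ the largest eigenvalue. $\nabla b(x)$ is the $r\times r$ matrix with entries $(\nabla b(x))_{i,j}=\partial_i b^j(x)$. $\|\cdot\|$ is the Euclidean norm. Since $\Sigma$ is constant, the Stratonovich and Itô forms of the equation for $X_t$ coincide. The equation for $\overline{X}_t(x)$ is an ordinary differential equation driven path by path by the piecewise smooth process $\overline{B}$.
   Formalization: The formal theorem adds that the approximation starts at 0 almost surely, like B; without this the first (almost sure) estimate fails when the approximation starts away from 0 and quickly returns to B. The moment estimate in general follows by subtracting the initial value. *)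

(* Defs.v *)
From HB Require Import structures.
From mathcomp Require Import all_boot all_order all_algebra.
From mathcomp Require Import all_classical all_reals all_analysis.
Set Implicit Arguments.
Unset Strict Implicit.
Unset Printing Implicit Defensive.
Import Order.TTheory GRing.Theory Num.Theory.
Import numFieldNormedType.Exports.
Local Open Scope classical_set_scope.
Local Open Scope ring_scope.

(* Points of R^r are row vectors, so that the product of a matrix S with a     *)
(* column vector v reads v *m S^T.                                             *)

Section Deterministic.
Variables (R : realType) (r : nat).

(* The Euclidean norm; the canonical norm of 'rV[R]_r is the sup norm. *)
Definition enorm (v : 'rV[R]_r) : R := Num.sqrt (\sum_(i < r) v 0 i ^+ 2).

(* For a symmetric matrix of positive size the set of eigenvalues is finite    *)
(* and nonempty, so this supremum is a maximum.                                *)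
Definition lambda_max (A : 'M[R]_r) : R := sup [set l : R | eigenvalue A l].

Definition log_norm (A : 'M[R]_r) : R := lambda_max (2^-1 *: (A + A^T)).

Definition partial (i : 'I_r) (f : 'rV[R]_r -> R) (x : 'rV[R]_r) : R :=
  'D_(delta_mx 0 i) f x.

Definition component (b : 'rV[R]_r -> 'rV[R]_r) (j : 'I_r) : 'rV[R]_r -> R :=
  fun x => b x 0 j.

Definition nabla (b : 'rV[R]_r -> 'rV[R]_r) (x : 'rV[R]_r) : 'M[R]_r :=
  \matrix_(i, j) partial i (component b j) x.

(* 'D_v f x is total, so the existence of the derivatives is a separate clause; *)
(* given continuous partial derivatives it amounts to differentiability.        *)
Definition bounded_C1 (f : 'rV[R]_r -> R) : Prop :=
  (forall x, differentiable f x) /\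
  forall i, continuous (partial i f) /\
            exists M : R, forall x, `|partial i f x| <= M.

Definition bounded_derivatives12 (b : 'rV[R]_r -> 'rV[R]_r) : Prop :=
  forall j, bounded_C1 (component b j) /\
            forall i, bounded_C1 (partial i (component b j)).

Definition smooth (g : R -> 'rV[R]_r) : Prop :=
  forall (n : nat) (t : R), derivable (derive1n n g) t 1.

(* Consecutive closed pieces share an end point: w is continuous on [0, +oo[.  *)
Definition piecewise_smooth (w : R -> 'rV[R]_r) : Prop :=
  exists (tau : nat -> R) (g : nat -> R -> 'rV[R]_r),
    [/\ tau 0%N = 0,
        forall n, tau n < tau n.+1,
        tau n @[n --> \oo] --> +oo,
        forall n, smooth (g n) &
        forall n t, tau n <= t <= tau n.+1 -> w t = g n t].

(* dy = b(y) dt + S dw along one path; as S is constant, the stochastic        *)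
(* integral of S against w is S (w t - w 0).                                   *)
Definition integral_solution (b : 'rV[R]_r -> 'rV[R]_r) (S : 'M[R]_r)
    (w : R -> 'rV[R]_r) (x : 'rV[R]_r) (y : R -> 'rV[R]_r) : Prop :=
  {within `[0, +oo[, continuous y} /\
  forall t, 0 <= t -> forall j,
    y t 0 j = x 0 j + \int[lebesgue_measure]_(s in `[0, t]) (b (y s) 0 j)
              + ((w t - w 0) *m S^T) 0 j.

(* dy/dt = b(y) + S dw/dt for a piecewise smooth w, away from the corners. *)
Definition ode_solution (b : 'rV[R]_r -> 'rV[R]_r) (S : 'M[R]_r)
    (w : R -> 'rV[R]_r) (x : 'rV[R]_r) (y : R -> 'rV[R]_r) : Prop :=
  [/\ {within `[0, +oo[, continuous y},
      y 0 = x &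
      forall t, 0 < t -> derivable w t 1 ->
        is_derive t 1 y (b (y t) + (derive1 w t) *m S^T)].

End Deterministic.

Section Probability.
Context (R : realType) (r : nat) (d : measure_display) (T : measurableType d).
Variable P : probability T R.

Definition stochastic_process (Y : R -> T -> 'rV[R]_r) : Prop :=
  forall t, 0 <= t -> forall i, measurable_fun setT (fun w => Y t w 0 i).

Definition mutually_independent (I : finType) (Y : I -> T -> R) : Prop :=
  forall (J : {set I}) (A : I -> set R), (forall i, measurable (A i)) ->
    P (\bigcap_(i in [set` J]) (Y i @^-1` A i)) =
    (\prod_(i in J) P (Y i @^-1` A i))%E.

(* The second parameter of normal_prob is the standard deviation. The last     *)
(* clause contains both the independence of the increments over disjoint time  *)
(* intervals and the independence of the r coordinates.                        *)
Definition brownian_motion (B : R -> T -> 'rV[R]_r) : Prop :=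
  [/\ stochastic_process B,
      {ae P, forall w, B 0 w = 0},
      {ae P, forall w, {within `[0, +oo[, continuous (B ^~ w)}},
      forall (s t : R) (i : 'I_r) (A : set R), 0 <= s -> s < t -> measurable A ->
        P ((fun w => B t w 0 i - B s w 0 i) @^-1` A) =
        normal_prob 0 (Num.sqrt (t - s)) A &
      forall (n : nat) (u : nat -> R),
        0 <= u 0%N -> (forall k, u k < u k.+1) ->
        mutually_independent (fun (ki : 'I_n * 'I_r) w =>
          B (u ki.1.+1) w 0 ki.2 - B (u ki.1) w 0 ki.2)].

(* The process starts at 0, like the Brownian motion that it approximates. *)
Definition piecewise_smooth_process (Bbar : R -> T -> 'rV[R]_r) : Prop :=
  [/\ stochastic_process Bbar,
      {ae P, forall w, Bbar 0 w = 0} &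
      {ae P, forall w, piecewise_smooth (Bbar ^~ w)}].

(* The flows are indexed by time, then by the starting point; the exceptional  *)
(* event does not depend on the starting point.                                *)
Definition sde_flow (b : 'rV[R]_r -> 'rV[R]_r) (S : 'M[R]_r)
    (B : R -> T -> 'rV[R]_r) (X : R -> 'rV[R]_r -> T -> 'rV[R]_r) : Prop :=
  (forall x, stochastic_process (fun t => X t x)) /\
  {ae P, forall w, forall x,
    integral_solution b S (B ^~ w) x (fun t => X t x w)}.

Definition ode_flow (b : 'rV[R]_r -> 'rV[R]_r) (S : 'M[R]_r)
    (Bbar : R -> T -> 'rV[R]_r) (X : R -> 'rV[R]_r -> T -> 'rV[R]_r) : Prop :=
  (forall x, stochastic_process (fun t => X t x)) /\
  {ae P, forall w, forall x,
    ode_solution b S (Bbar ^~ w) x (fun t => X t x w)}.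

Definition uniform_dist (Y Z : 'rV[R]_r -> T -> 'rV[R]_r) (w : T) : \bar R :=
  ereal_sup [set (enorm (Y x w - Z x w))%:E | x in [set: 'rV[R]_r]].

Definition sup_time_Lp (p : R) (f : R -> T -> \bar R) : \bar R :=
  ereal_sup [set ('N[P]_(p%:E)[f t])%E | t in `[0, +oo[].

End Probability.

(* Main.v *)
Require Import Defs.
From HB Require Import structures.
From mathcomp Require Import all_boot all_order all_algebra.
From mathcomp Require Import all_classical all_reals all_analysis.
From mathcomp Require Import measurable_realfun ring lra.
Import Order.TTheory GRing.Theory Num.Theory.
Import numFieldNormedType.Exports.
Local Open Scope classical_set_scope.
Local Open Scope ring_scope.

(** The two equations carry the same additive noise up to the gap
    D = B - Bbar, so the noise is removed first: along one path and from one
    starting point x, the residual Z = X(x) - Xbar(x) - Sigma D starts at 0, is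
    continuous, and away from the corners of Bbar has the derivative
    b(X) - b(Xbar), whatever the roughness of B.  Writing
    X = Xbar + Sigma D + Z, this derivative splits into
    b(Xbar + Sigma D + Z) - b(Xbar + Sigma D), whose inner product with Z is at
    most - l |Z|^2 because the logarithmic norm of the Jacobian of b is at most
    - l [one_sided_lipschitz], and b(Xbar + Sigma D) - b(Xbar), which is
    O(|D|) since b is Lipschitz [lipschitz_sqr].  Young's inequality absorbs the
    cross term in half of the contraction, so that
    (|Z|^2)' <= - l |Z|^2 + C |D|^2, and the integrating factor exp(l t) gives
    |Z_t|^2 <= C \int_0^t exp(- l (t - s)) |D_s|^2 ds [pathwise_sqr_le].  The
    right-hand side does not depend on x: this is the almost sure estimate, with
    lambda = l / 2.

    The logarithmic norm enters through the Rayleigh bound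
    <v A, v> <= log_norm A |v|^2 [log_norm_ge]: a maximiser of the quadratic form
    of a symmetric matrix on the unit sphere is an eigenvector.

    For the moments, p is replaced by an even integer 2n >= p.  Since
    u^p <= k^p (1 + (u/k)^(2n)), a bound of order k^(2n) on the moment of order
    2n yields one of order k^p on the moment of order p; the choice
    k = sqrt eps keeps the announced rate.  Jensen's inequality for the weight
    exp(- l (t - s)), whose mass is at most 1/l uniformly in t, moves the n-th
    power inside the time integral [weight_jensen], and Tonelli's theorem
    exchanges it with the expectation [time_average_expectation].  Tonelli needs
    joint measurability in time and chance, which follows from the continuity of
    the paths [jointly_measurable_of_continuous].  The supremum over the starting
    points may fail to be measurable; its p-th moment is then an upper integral,
    which is still monotone with respect to measurable majorants
    [ae_ge0_le_integral_nonmeasurable]. *)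

Set Implicit Arguments.
Unset Strict Implicit.
Unset Printing Implicit Defensive.

(** * Euclidean geometry and the logarithmic norm *)

Section Euclid.
Context {R : realType} {r : nat}.
Implicit Types (u v w : 'rV[R]_r) (A : 'M[R]_r).

(** The Euclidean inner product; row vectors carry the sup norm, so the inner
    product is introduced by its coordinates. *)
Definition dot u v : R := \sum_(i < r) u 0 i * v 0 i.

Lemma dotC u v : dot u v = dot v u.
Proof. by apply: eq_bigr => i _; rewrite mulrC. Qed.

Lemma dotDl u v w : dot (u + v) w = dot u w + dot v w.
Proof. by rewrite -big_split; apply: eq_bigr => i _; rewrite mxE mulrDl. Qed.

Lemma dotZl (a : R) u w : dot (a *: u) w = a * dot u w.
Proof. by rewrite mulr_sumr; apply: eq_bigr => i _; rewrite mxE mulrA. Qed.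

Lemma dotDr u v w : dot w (u + v) = dot w u + dot w v.
Proof. by rewrite dotC dotDl !(dotC w). Qed.

Lemma dotZr (a : R) u w : dot w (a *: u) = a * dot w u.
Proof. by rewrite dotC dotZl dotC. Qed.

Lemma dotNl u w : dot (- u) w = - dot u w.
Proof. by rewrite -scaleN1r dotZl mulN1r. Qed.

Lemma dotNr u w : dot w (- u) = - dot w u.
Proof. by rewrite dotC dotNl dotC. Qed.

Lemma dot0l u : dot 0 u = 0.
Proof. by apply: big1 => i _; rewrite mxE mul0r. Qed.

Definition dotE := (dotDl, dotDr, dotZl, dotZr, dotNl, dotNr).

Lemma dot_ge0 u : 0 <= dot u u.
Proof. by apply: sumr_ge0 => i _; rewrite -expr2 sqr_ge0. Qed.

Lemma dot_eq0 u : dot u u = 0 -> u = 0.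
Proof.
move/eqP; rewrite psumr_eq0; last by move=> i _; rewrite -expr2 sqr_ge0.
move/allP => u0; apply/rowP => i; rewrite mxE; apply/eqP.
by have := u0 i (mem_index_enum i); rewrite mulf_eq0 orbb.
Qed.

Lemma enorm_ge0 u : 0 <= enorm u.
Proof. exact: sqrtr_ge0. Qed.

Lemma enorm_sqr u : enorm u ^+ 2 = dot u u.
Proof.
rewrite sqr_sqrtr; first by apply: eq_bigr => i _; rewrite expr2.
by apply: sumr_ge0 => i _; rewrite sqr_ge0.
Qed.

(** The squared length of |v|^2 u - <u, v> v is |v|^2 times the difference of the
    two sides. *)
Lemma dot_cauchy_schwarz u v : dot u v ^+ 2 <= dot u u * dot v v.
Proof.
have := dot_ge0 v; rewrite le_eqVlt => /predU1P[/esym /dot_eq0 ->|v0].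
  by rewrite dotC !dot0l mulr0 expr0n.
have := dot_ge0 (dot v v *: u - dot u v *: v).
rewrite !dotE (dotC v u) => h.
by rewrite -subr_ge0 -(pmulr_rge0 _ v0); apply: le_trans h _; rewrite le_eqVlt;
   apply/orP; left; apply/eqP; ring.
Qed.

Lemma sumr_cvg (T I : Type) (F : set_system T) {FF : Filter F} (s : seq I)
    (f : I -> T -> R) (a : I -> R) :
  (forall i, f i x @[x --> F] --> a i) ->
  \sum_(i <- s) f i x @[x --> F] --> \sum_(i <- s) a i.
Proof.
move=> fa; elim: s => [|i s IH].
  by rewrite big_nil; under eq_cvg do rewrite big_nil; exact: cvg_cst.
rewrite big_cons; under eq_cvg do rewrite big_cons.
exact: cvgD.
Qed.

Lemma dot_cvg (T : Type) (F : set_system T) {FF : Filter F} (f g : T -> 'rV[R]_r) u v :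
  (forall i, f x 0 i @[x --> F] --> u 0 i) ->
  (forall i, g x 0 i @[x --> F] --> v 0 i) ->
  dot (f x) (g x) @[x --> F] --> dot u v.
Proof. by move=> fu gv; apply: sumr_cvg => i; apply: cvgM. Qed.

Lemma mulmx_coord_cvg (T : Type) (F : set_system T) {FF : Filter F}
    (f : T -> 'rV[R]_r) v A i :
  (forall i, f x 0 i @[x --> F] --> v 0 i) ->
  (f x *m A) 0 i @[x --> F] --> (v *m A) 0 i.
Proof.
move=> fv; rewrite mxE; under eq_fun do rewrite mxE.
by apply: sumr_cvg => j; apply: cvgM => //; exact: cvg_cst.
Qed.

Lemma dot_mulmx_sqr v A :
  dot (v *m A) (v *m A) <= (\sum_(i < r) \sum_(j < r) A j i ^+ 2) * dot v v.
Proof.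
rewrite mulr_suml; apply: ler_sum => i _.
have := dot_cauchy_schwarz v (\row_j A j i).
have -> : dot v (\row_j A j i) = (v *m A) 0 i.
  by rewrite mxE; apply: eq_bigr => j _; rewrite mxE.
have -> : dot (\row_j A j i) (\row_j A j i) = \sum_(j < r) A j i ^+ 2.
  by apply: eq_bigr => j _; rewrite mxE.
by rewrite expr2 (mulrC (dot v v)).
Qed.

Lemma dot_mulmx_sym u v A : A^T = A -> dot (u *m A) v = dot u (v *m A).
Proof.
move=> At; rewrite /dot.
under eq_bigr do rewrite mxE mulr_suml.
under [RHS]eq_bigr do rewrite mxE mulr_sumr.
rewrite exchange_big /=; apply: eq_bigr => i _; apply: eq_bigr => j _.
by rewrite -{1}At mxE -mulrA (mulrC (A _ _)).
Qed.

Lemma unit_sphere_compact : compact [set v : 'rV[R]_r | dot v v = 1].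
Proof.
apply: bounded_closed_compact.
  exists 1; split; first exact: num_real.
  move=> M M1 v /= v1; rewrite /Num.Def.normr/= mx_normrE.
  apply: bigmax_le; first exact: le_trans ler01 (ltW M1).
  move=> [i j] _ /=; rewrite (le_trans _ (ltW M1)) // (ord1 i).
  rewrite -(@ler_pXn2r _ 2) ?nnegrE // expr1n -normrX ger0_norm ?sqr_ge0 //.
  rewrite -v1 /dot (bigD1 j) //= -expr2 lerDl.
  by apply: sumr_ge0 => k _; rewrite -expr2 sqr_ge0.
rewrite (_ : [set v | _] = (fun v => dot v v) @^-1` [set 1]) //.
apply: closed_comp; last exact: closed_eq.
by move=> v _; apply: (@dot_cvg _ (nbhs v)) => i; exact: coord_continuous.
Qed.

(** The quadratic form q attains its maximum on the unit sphere at some c, and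
    perturbing c in the direction of w = c A - q(c) c shows that w = 0: hence
    q(c) is an eigenvalue, and it bounds all of them, so that the supremum
    defining lambda_max is at least q(c). *)
Lemma rayleigh_le v A : A^T = A -> dot (v *m A) v <= lambda_max A * dot v v.
Proof.
move=> At.
have [->|v0] := eqVneq v 0.
  by rewrite mul0mx !dot0l mulr0.
pose q u := dot (u *m A) u.
have qZ a u : q (a *: u) = a ^+ 2 * q u.
  by rewrite /q -scalemxAl !dotE; ring.
have unitv u : u != 0 -> dot ((Num.sqrt (dot u u))^-1 *: u) ((Num.sqrt (dot u u))^-1 *: u) = 1.
  move=> u0; rewrite !dotE mulrA -expr2 exprVn sqr_sqrtr ?dot_ge0 // mulVf //.
  by apply: contraNneq u0 => /dot_eq0 ->.
have cq : {within [set v : 'rV[R]_r | dot v v = 1], continuous q}.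
  apply: continuous_subspaceT => u.
  apply: (@dot_cvg _ (nbhs u)) => i; last exact: coord_continuous.
  by apply: (@mulmx_coord_cvg _ (nbhs u)) => j; exact: coord_continuous.
have [|c] := EVT_max_rV _ unit_sphere_compact cq.
  by eexists; exact: unitv v0.
rewrite inE /= => c1 cmax.
have qle u : q u <= q c * dot u u.
  have [->|u0] := eqVneq u 0.
    by rewrite /q mul0mx !dot0l mulr0.
  have s0 : 0 < dot u u.
    by rewrite lt_neqAle dot_ge0 andbT eq_sym; apply: contraNneq u0 => /dot_eq0 ->.
  have := cmax _ (mem_set (unitv u u0)).
  by rewrite qZ exprVn sqr_sqrtr ?dot_ge0 // mulrC ler_pdivrMr.
have eigc : c *m A = q c *: c.
  pose w := c *m A - q c *: c.
  (* The expansion of q(c + t h) <= q(c) |c + t h|^2; the terms of order 0 cancel. *)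
  have cA h t : 2 * t * dot w h + t ^+ 2 * (q h - q c * dot h h) <= 0.
    have := qle (c + t *: h); rewrite {1}/q mulmxDl -scalemxAl !dotE c1.
    rewrite (dotC h c) (dot_mulmx_sym h c) // -(dotC (c *m A)) -/(q h) -/(q c).
    rewrite -subr_le0 => h0.
    by apply: le_trans h0; rewrite le_eqVlt; apply/orP; left; apply/eqP; ring.
  suff /dot_eq0 /eqP : dot w w = 0 by rewrite subr_eq0 => /eqP.
  apply/eqP; rewrite eq_le dot_ge0 andbT leNgt; apply/negP => w0.
  (* With h = w, the linear term 2 t |w|^2 would beat t^2 K for small t > 0. *)
  set K := q c * dot w w - q w.
  have K0 : 0 <= K by rewrite subr_ge0 qle.
  have K1 : 0 < K + 1 by rewrite ltr_wpDl.
  have [t t0 tK] : exists2 t, 0 < t & t * (K + 1) = dot w w.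
    by exists (dot w w / (K + 1)); [rewrite divr_gt0|rewrite divfK // gt_eqF].
  have := cA w t; rewrite -[q w - _]opprB -/K -tK leNgt => /negP; apply.
  have -> : 2 * t * (t * (K + 1)) + t ^+ 2 * - K = t * (t * (K + 1 + 1)) by ring.
  by rewrite !mulr_gt0 // ltr_wpDl // ltW.
have eigle l : eigenvalue A l -> l <= q c.
  case/eigenvalueP => u uA u0.
  have s0 : 0 < dot u u.
    by rewrite lt_neqAle dot_ge0 andbT eq_sym; apply: contraNneq u0 => /dot_eq0 ->.
  by have := qle u; rewrite /q uA dotZl ler_pM2r.
apply: le_trans (qle v) _; apply: ler_wpM2r; first exact: dot_ge0.
apply: ub_le_sup; first by exists (q c) => l /= /eigle.
rewrite /=; apply/eigenvalueP; exists c => //.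
apply/eqP => c0; move/eqP: c1; rewrite c0 dot0l.
by rewrite eq_sym oner_eq0.
Qed.

(** A matrix and its symmetric part have the same quadratic form. *)
Lemma log_norm_ge v A : dot (v *m A) v <= log_norm A * dot v v.
Proof.
have -> : dot (v *m A) v = dot (v *m (2^-1 *: (A + A^T))) v.
  rewrite -scalemxAr mulmxDr !dotE.
  suff -> : dot (v *m A^T) v = dot (v *m A) v by lra.
  rewrite /dot; under eq_bigr do rewrite mxE mulr_suml.
  rewrite exchange_big /=; under [RHS]eq_bigr do rewrite mxE mulr_suml.
  by apply: eq_bigr => i _; apply: eq_bigr => j _; rewrite mxE; ring.
by apply: rayleigh_le; rewrite linearZ /= linearD /= trmxK addrC.
Qed.

End Euclid.

(** * One-sided and two-sided Lipschitz bounds for the drift *)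

Section VectorField.
Context {R : realType} {r : nat}.
Implicit Types (f : 'rV[R]_r -> R) (x h : 'rV[R]_r).

Definition grad f x : 'rV[R]_r := \row_i partial i f x.

Lemma is_derive_line f x h (s : R) : (forall y, differentiable f y) ->
  is_derive s 1 (fun t : R => f (x + t *: h)) (dot h (grad f (x + s *: h))).
Proof.
move=> df; set y := x + s *: h.
have Ey : (fun t : R => t^-1 *: ((fun u : R => f (x + u *: h)) (t *: (1 : R) + s) - f y)) =
          (fun t : R => t^-1 *: (f (t *: h + y) - f y)).
  apply/funext => t; congr (_ *: (f _ - _)).
  by rewrite [t *: (1 : R)]mulr1 scalerDl addrCA.
have dE : 'D_h f y = dot h (grad f y).
  rewrite deriveE // {1}(row_sum_delta h) linear_sum /dot.
  apply: eq_bigr => i _; rewrite linearZ /= mxE /partial deriveE //.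
apply: DeriveDef.
  by rewrite /derivable /= Ey; exact: diff_derivable.
by rewrite -dE /derive /= Ey.
Qed.

Lemma line_continuous f x h : (forall y, differentiable f y) ->
  {within `[0, 1], continuous (fun t : R => f (x + t *: h))}.
Proof.
move=> df; apply: derivable_within_continuous => t _.
by have [] := is_derive_line x h t df.
Qed.

Lemma mean_value_grad f x h : (forall y, differentiable f y) ->
  exists s : R, f (x + h) - f x = dot h (grad f (x + s *: h)).
Proof.
move=> df.
have [s _ fs] := MVT ltr01 (fun s _ => is_derive_line x h s df) (@line_continuous f x h df).
by exists s; move: fs; rewrite scale1r scale0r addr0 subr0 mulr1.
Qed.

Variable b : 'rV[R]_r -> 'rV[R]_r.
Hypothesis bD : bounded_derivatives12 b.

(** The mean value theorem for each component, with Cauchy-Schwarz against the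
    gradient, whose entries are bounded. *)
Lemma lipschitz_sqr : exists2 L : R, 0 <= L &
  forall x h, dot (b (x + h) - b x) (b (x + h) - b x) <= L * dot h h.
Proof.
have /fin_all_exists [L LP] : forall j : 'I_r, exists L : R, 0 <= L /\
    forall x h, ((b (x + h) - b x) 0 j) ^+ 2 <= L * dot h h.
  move=> j; have [[df pb] _] := bD j.
  have /fin_all_exists [M MP] : forall i : 'I_r, exists M : R,
      forall x, `|partial i (component b j) x| <= M.
    by move=> i; have [] := pb i.
  exists (\sum_i M i ^+ 2); split; first by apply: sumr_ge0 => i _; exact: sqr_ge0.
  move=> x h; have [s] := mean_value_grad x h df.
  rewrite /component !mxE => ->.
  apply: le_trans (dot_cauchy_schwarz _ _) _.
  rewrite mulrC; apply: ler_wpM2r; first exact: dot_ge0.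
  apply: ler_sum => i _; rewrite mxE -expr2 -(real_normK (num_real _)).
  by rewrite lerXn2r ?nnegrE // (le_trans _ (MP i x)).
exists (\sum_j L j); first by apply: sumr_ge0 => j _; have [] := LP j.
move=> x h; rewrite mulr_suml; apply: ler_sum => j _.
by rewrite -expr2; have [_] := LP j; apply.
Qed.

(** Along the segment from x to x + h, the derivative of s |-> <h, b(x + s h)> is
    the quadratic form of the Jacobian at h. *)
Lemma one_sided_lipschitz :
  sup [set log_norm (nabla b x) | x in [set: 'rV[R]_r]] < 0 ->
  forall x h, dot h (b (x + h) - b x) <=
    sup [set log_norm (nabla b x) | x in [set: 'rV[R]_r]] * dot h h.
Proof.
set E := (X in sup X) => supE x h.
(* The supremum of a set that is empty or unbounded above is 0 by convention, so
   a negative supremum is a genuine one. *)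
have hE : has_sup E.
  by apply: contrapT => /sup_out E0; rewrite E0 ltxx in supE.
pose phi (s : R) := \sum_j h 0 j * component b j (x + s *: h).
have dphi (s : R) : is_derive s 1 phi (dot (h *m nabla b (x + s *: h)) h).
  have -> : phi = \sum_j (h 0 j *: (fun s : R => component b j (x + s *: h))).
    by apply/funext => u; rewrite fct_sumE.
  have -> : dot (h *m nabla b (x + s *: h)) h =
      \sum_j h 0 j *: dot h (grad (component b j) (x + s *: h)).
    apply: eq_bigr => j _; rewrite mulrC; congr (_ * _).
    by rewrite mxE; apply: eq_bigr => i _; rewrite !mxE.
  apply: is_derive_sum => j.
  by apply: is_deriveZ; apply: is_derive_line; have [[]] := bD j.
have [|s _] := MVT ltr01 (fun s _ => dphi s).
  by apply: derivable_within_continuous => t _; have [] := dphi t.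
rewrite subr0 mulr1.
have -> : phi 1 - phi 0 = dot h (b (x + h) - b x).
  rewrite /phi -sumrB; apply: eq_bigr => j _.
  by rewrite scale1r scale0r addr0 -mulrBr !mxE.
move=> ->; apply: le_trans (log_norm_ge _ _) _.
apply: ler_wpM2r; first exact: dot_ge0.
by apply: sup_upper_bound => //; exists (x + s *: h).
Qed.

End VectorField.

(** * Functions that are regular between the points of a grid *)

Section Pieces.
Context {R : realType}.

Lemma within0T (U : topologicalType) (f : R -> U) (T : R) :
  {within `[0, +oo[, continuous f} -> {within `[0, T], continuous f}.
Proof.
apply: continuous_subspaceW => s /=; rewrite !in_itv /= andbT.
by case/andP.
Qed.

Lemma within_continuous_at (U : topologicalType) (f : R -> U) (T t : R) :
  {within `[0, T], continuous f} -> 0 < t -> t < T -> {for t, continuous f}.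
Proof.
move=> cf t0 tT.
have : {within `]0, T[, continuous f}.
  by apply: continuous_subspaceW cf; exact: subset_itv_oo_cc.
rewrite continuous_open_subspace; last exact: interval_open.
by apply; rewrite inE /= in_itv /= t0.
Qed.

Lemma within_mx_coord {r : nat} (A : set R) (y : R -> 'rV[R]_r) (j : 'I_r) :
  {within A, continuous y} -> {within A, continuous (fun t => y t 0 j)}.
Proof.
move=> cy t; apply: (@continuous_comp (subspace A) _ _ y (fun v : 'rV[R]_r => v 0 j)).
  exact: cy.
exact: coord_continuous.
Qed.

Lemma is_derive_coord {r : nat} (y : R -> 'rV[R]_r) (dy : 'rV[R]_r) (t : R) j :
  is_derive t 1 y dy -> is_derive t 1 (fun s => y s 0 j) (dy 0 j).
Proof.
move=> [dty <-]; apply: DeriveDef; first exact: (derivable_mxP _ _ _).1.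
by rewrite derive_mx // mxE.
Qed.

Section Grid.
Variable tau : nat -> R.
Hypotheses (tau0 : tau 0%N = 0) (tauS : forall n, tau n < tau n.+1)
  (tauoo : tau n @[n --> \oo] --> +oo).

Lemma grid_ge0 n : 0 <= tau n.
Proof. by elim: n => [|n IH]; rewrite ?tau0 // (le_trans IH) // ltW. Qed.

Lemma grid_exhausts T : exists n, T <= tau n.
Proof.
have /cvgryPge /(_ T) [n _ nT] := tauoo.
by exists n; apply: nT => /=.
Qed.

(** The corners do not spoil monotonicity: V is continuous across them, and only
    finitely many precede a given time. *)
Lemma grid_nonincreasing (V : R -> R) :
  (forall T, {within `[0, T], continuous V}) ->
  (forall n t, tau n < t < tau n.+1 -> exists2 v, is_derive t 1 V v & v <= 0) ->
  forall t, 0 <= t -> V t <= V 0.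
Proof.
move=> cV dV t t0; have [N] := grid_exhausts t.
elim: N t t0 => [|N IH] t t0 tN.
  by rewrite (_ : t = 0) //; apply/eqP; rewrite eq_le t0 andbT -tau0.
have [/IH -> //|Nt] := leP t (tau N).
apply: le_trans (IH _ (grid_ge0 N) (lexx _)).
apply: (@ler0_derive1_le_cc _ V (tau N) (tau N.+1)).
- by move=> s; rewrite in_itv /= => /dV [v []].
- by move=> s; rewrite in_itv /= => /dV [v [ds <-]]; rewrite derive1E.
- apply: continuous_subspaceW (cV (tau N.+1)).
  by apply: subset_itvr; rewrite bnd_simp grid_ge0.
- by rewrite in_itv /= tN ltW.
- by rewrite in_itv /= lexx ltW.
- exact: ltW.
Qed.

Lemma grid_glue (U : topologicalType) (w : R -> U) :
  (forall n, {within `[tau n, tau n.+1], continuous w}) ->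
  forall T, {within `[0, T], continuous w}.
Proof.
move=> cw T; have [N TN] := grid_exhausts T.
apply: (@continuous_subspaceW _ _ _ `[0, tau N]).
  by apply: subset_itvl; rewrite bnd_simp.
elim: N {TN} => [|N IH].
  by rewrite tau0 set_itv1; exact: continuous_subspace1.
rewrite (_ : `[0, tau N.+1]%classic = `[0, tau N]%classic `|` `[tau N, tau N.+1]%classic).
  by apply: withinU_continuous => //; exact: interval_closed.
apply/seteqP; split => s /=; rewrite !in_itv /=.
  move=> /andP[s0 sN]; have [sN'|/ltW Ns] := leP s (tau N); [left|right].
    by rewrite s0.
  by rewrite Ns sN.
case=> /andP[a b].
  by rewrite a (le_trans b) // ltW.
by rewrite b (le_trans _ a) // grid_ge0.
Qed.

End Grid.

Lemma smooth_continuous {r : nat} (g : R -> 'rV[R]_r) : smooth g -> continuous g.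
Proof.
move=> sg t; apply/differentiable_continuous/derivable1_diffP; exact: (sg 0%N t).
Qed.

End Pieces.

(** * The pathwise comparison of the two solutions *)

Lemma within_coord_cvg {R : realType} {r : nat} (T : R) (y : R -> 'rV[R]_r)
    (t : subspace `[0, T]%classic) (j : 'I_r) :
  {within `[0, T], continuous y} ->
  y s 0 j @[s --> t] --> y t 0 j.
Proof. by move=> cy; have h := @within_mx_coord _ _ _ _ j cy t; exact: h. Qed.

Section Primitive.
Context {R : realType}.
Notation mu := lebesgue_measure.

Lemma within_integrable (f : R -> R) (T : R) :
  {within `[0, T], continuous f} -> mu.-integrable `[0, T] (EFin \o f).
Proof. by move=> cf; apply: continuous_compact_integrable => //; exact: segment_compact. Qed.

Lemma within_primitive_continuous (f : R -> R) :
  (forall T, {within `[0, T], continuous f}) ->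
  forall T, {within `[0, T], continuous (fun t : R => \int[mu]_(s in `[0, t]) f s)}.
Proof.
move=> cf T; have [T0|T0] := leP 0 T.
  apply: parameterized_integral_continuous => //.
  exact: within_integrable.
rewrite set_itv_ge; last by rewrite bnd_simp -ltNge.
exact: continuous_subspace0.
Qed.

Lemma is_derive_primitive (f : R -> R) :
  (forall T, {within `[0, T], continuous f}) ->
  forall t : R, 0 < t -> is_derive t 1 (fun t : R => \int[mu]_(s in `[0, t]) f s) (f t).
Proof.
move=> cf t t0.
have tt1 : t < t + 1 by rewrite ltrDl.
have [d e] := continuous_FTC1_closed tt1 (within_integrable (cf (t + 1))) t0
  (within_continuous_at (cf (t + 1)) t0 tt1).
by apply: DeriveDef; [exact: d|rewrite -derive1E; exact: e].
Qed.

End Primitive.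

Lemma dot_young {R : realType} {r : nat} (l : R) (u v : 'rV[R]_r) :
  0 < l -> 2 * dot u v <= l * dot u u + dot v v / l.
Proof.
move=> l0; have := dot_ge0 (l *: u - v).
rewrite !dotE (dotC v u) => h.
rewrite -subr_ge0 -(pmulr_rge0 _ l0); apply: le_trans h _.
rewrite le_eqVlt; apply/orP; left; apply/eqP.
by field; rewrite gt_eqF.
Qed.

Section Pathwise.
Context {R : realType} {r : nat}.
Notation mu := lebesgue_measure.
Variables (b : 'rV[R]_r -> 'rV[R]_r) (S : 'M[R]_r) (l L K : R).
Hypotheses (l0 : 0 < l)
  (b_dissipative : forall x h : 'rV[R]_r, dot h (b (x + h) - b x) <= - l * dot h h)
  (b_lipschitz : forall x h : 'rV[R]_r,
     dot (b (x + h) - b x) (b (x + h) - b x) <= L * dot h h)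
  (S_bounded : forall v : 'rV[R]_r, dot (v *m S^T) (v *m S^T) <= K * dot v v)
  (L0 : 0 <= L)
  (b_cont : forall j, continuous (component b j)).

(** The first increment of b contracts along z and the second one is Lipschitz;
    Young's inequality spends half of the contraction 2 l |z|^2 on the cross
    term. *)
Lemma drift_estimate (v h z : 'rV[R]_r) :
  2 * dot z (b (v + h + z) - b v) <= - l * dot z z + L * dot h h / l.
Proof.
have -> : b (v + h + z) - b v = (b (v + h + z) - b (v + h)) + (b (v + h) - b v).
  by rewrite addrA subrK.
have h1 := b_dissipative (v + h) z.
have h2 := b_lipschitz v h.
have h3 := dot_young z (b (v + h) - b v) l0.
have h4 : dot (b (v + h) - b v) (b (v + h) - b v) / l <= L * dot h h / l.
  by rewrite ler_pM2r ?invr_gt0.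
rewrite dotDr mulrDr.
lra.
Qed.

Variables (w1 w2 : R -> 'rV[R]_r) (x : 'rV[R]_r) (y1 y2 : R -> 'rV[R]_r).
Hypotheses (w10 : w1 0 = 0) (w20 : w2 0 = 0)
  (w1c : {within `[0, +oo[, continuous w1}) (w2s : piecewise_smooth w2)
  (y1s : integral_solution b S w1 x y1) (y2s : ode_solution b S w2 x y2).

Let gap t := w1 t - w2 t.
Let drift_primitive j t := \int[mu]_(s in `[0, t]) (b (y1 s) 0 j).
Let corrected t := y2 t - w2 t *m S^T.
Let residual t := y1 t - y2 t - gap t *m S^T.

Lemma drift_within j T : {within `[0, T], continuous (fun s => b (y1 s) 0 j)}.
Proof.
have [cy _] := y1s => t.
apply: (@continuous_comp (subspace `[0, T]) _ _ y1 (component b j)).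
  exact: (within0T cy).
exact: b_cont.
Qed.

(** The noise w1, which need not be differentiable, cancels: what is left is the
    primitive of b(y1) and the corrected solution y2 - w2 S^T. *)
Lemma residual_coordE j t : 0 <= t ->
  residual t 0 j = drift_primitive j t - (corrected t 0 j - x 0 j).
Proof.
move=> t0; have [_ /(_ t t0 j) e] := y1s.
by rewrite /residual /corrected /gap mulmxBl !mxE e w10 subr0 !mxE /drift_primitive; ring.
Qed.

Lemma piecewise_smooth_within T : {within `[0, T], continuous w2}.
Proof.
have [tau [g [tau0 tauS tauoo gs wg]]] := w2s.
apply: (grid_glue tau0 tauS tauoo) => n.
apply: (@subspace_eq_continuous _ _ _ (g n)).
  by move=> t; rewrite inE /= in_itv /= => tn; exact/esym/wg.
by apply: continuous_subspaceT; exact: smooth_continuous.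
Qed.

Lemma corrected_within j T : {within `[0, T], continuous (fun t : R => corrected t 0 j)}.
Proof.
have [cy _ _] := y2s => t.
rewrite (_ : (fun t => corrected t 0 j) = (fun t => y2 t 0 j - (w2 t *m S^T) 0 j)); last first.
  by apply/funext => s; rewrite /corrected !mxE.
apply: cvgB; first exact: (@within_coord_cvg _ _ T _ t j (@within0T _ _ _ T cy)).
apply: (@mulmx_coord_cvg _ _ _ (nbhs (t : subspace `[0, T]))) => i.
exact: (@within_coord_cvg _ _ T _ t i (@piecewise_smooth_within T)).
Qed.

Lemma weighted_gap_within (e : R -> R) : continuous e ->
  forall T, {within `[0, T], continuous (fun s => e s * dot (gap s) (gap s))}.
Proof.
move=> ce T; have cD : {within `[0, T], continuous gap}.
  move=> t; apply: cvgB; first exact: (@within0T _ _ _ T w1c t).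
  exact: (@piecewise_smooth_within T t).
move=> t; apply: cvgM; first exact (@continuous_subspaceT _ _ `[0, T]%classic e ce t).
by apply: (@dot_cvg _ _ _ (nbhs (t : subspace `[0, T])) _ gap gap) => i;
  exact (@within_coord_cvg _ _ T gap t i cD).
Qed.

(** The derivative of w2 cancels between the equation of y2 and the correction. *)
Lemma is_derive_corrected (t : R) : 0 < t -> derivable w2 t 1 ->
  forall j, is_derive t 1 (fun s : R => corrected s 0 j) (b (y2 t) 0 j).
Proof.
move=> t0 dw j; have [_ _ /(_ t t0 dw) dy] := y2s.
have dw' : is_derive t 1 w2 (derive1 w2 t) by apply: DeriveDef; rewrite ?derive1E.
have -> : (fun s => corrected s 0 j) =
    (fun s : R => y2 s 0 j) - \sum_i (S j i *: (fun s : R => w2 s 0 i)).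
  apply/funext => s; rewrite /corrected !mxE /= -[RHS]/(y2 s 0 j - _ s); congr (_ - _).
  by rewrite fct_sumE; apply: eq_bigr => i _; rewrite mxE mulrC.
have -> : b (y2 t) 0 j = (b (y2 t) + derive1 w2 t *m S^T) 0 j -
    \sum_i (S j i *: derive1 w2 t 0 i).
  rewrite !mxE -addrA -[LHS]addr0; congr (_ + _); apply/esym/eqP.
  by rewrite subr_eq0; apply/eqP/eq_bigr => i _; rewrite mxE mulrC.
apply: is_deriveB; first exact: is_derive_coord.
by apply: is_derive_sum => i; apply: is_deriveZ; exact: is_derive_coord.
Qed.

Let residual_coord j : R -> R :=
  fun t => drift_primitive j t - (corrected t 0 j - x 0 j).
Let gap_primitive (t : R) : R :=
  \int[mu]_(s in `[0, t]) (expR (l * s) * dot (gap s) (gap s)).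
Let C := L * K / l.

(** The integrating factor turns the inequality (|z|^2)' <= - l |z|^2 + C |D|^2 for
    the residual z and the gap D into the monotonicity of this function.  It is
    written with operations on functions so that the rules of differentiation
    apply to it. *)
Let energy : R -> R :=
  (expR \o ( *%R l)) * (\sum_j (residual_coord j ^+ 2)) - C *: gap_primitive.

Lemma energyE t : 0 <= t ->
  energy t = expR (l * t) * dot (residual t) (residual t) - C * gap_primitive t.
Proof.
move=> t0; rewrite /energy.
rewrite -[LHS]/(expR (l * t) * (\sum_j (residual_coord j ^+ 2)) t - C * gap_primitive t).
congr (_ * _ - _); rewrite fct_sumE; apply: eq_bigr => j _.
by rewrite residual_coordE // -expr2.
Qed.

Lemma expR_scale_continuous : continuous (fun s : R => expR (l * s)).
Proof.
move=> s; apply: (@continuous_comp _ _ _ ( *%R l) expR).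
  exact: mulrl_continuous.
exact: continuous_expR.
Qed.

Lemma energy_at0 : energy 0 = 0.
Proof.
rewrite energyE // /gap_primitive set_itv1 Rintegral_set1 !mulr0 subr0 expR0 mul1r.
apply: big1 => j _; rewrite residual_coordE // /drift_primitive set_itv1 Rintegral_set1.
rewrite /corrected w20 mul0mx subr0.
by have [_ -> _] := y2s; rewrite subrr subr0 mul0r.
Qed.

Lemma energy_cvg (A : set_system R) {FA : Filter A} (t : R) :
  (forall j, drift_primitive j @ A --> drift_primitive j t) ->
  (forall j, corrected s 0 j @[s --> A] --> corrected t 0 j) ->
  gap_primitive @ A --> gap_primitive t ->
  expR (l * s) @[s --> A] --> expR (l * t) -> energy @ A --> energy t.
Proof.
move=> cF cY cG cE.
have cZ j : residual_coord j @ A --> residual_coord j t.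
  by apply: cvgB => //; apply: cvgB => //; exact: cvg_cst.
rewrite /energy; apply: cvgB; last exact: cvgZr.
apply: cvgM; first exact: cE.
rewrite fct_sumE; apply: sumr_cvg => j.
by apply: cvgM; exact: cZ.
Qed.

Lemma energy_within T : {within `[0, T], continuous energy}.
Proof.
have cF j := @within_primitive_continuous _ _ (@drift_within j) T.
have cY j := @corrected_within j T.
have cG := @within_primitive_continuous _ _ (weighted_gap_within expR_scale_continuous) T.
move=> t; apply: (@energy_cvg (nbhs (t : subspace `[0, T]%classic)) _ t).
- by move=> j; exact (cF j t).
- by move=> j; exact (cY j t).
- exact (cG t).
- exact (@continuous_subspaceT _ _ `[0, T]%classic _ expR_scale_continuous t).
Qed.

Lemma energy_derive_le0 (t : R) : 0 < t -> derivable w2 t 1 ->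
  exists2 v, is_derive t 1 energy v & v <= 0.
Proof.
move=> t0 dw.
have dF j := is_derive_primitive (@drift_within j) t0.
have dY := is_derive_corrected t0 dw.
have dG := is_derive_primitive (weighted_gap_within expR_scale_continuous) t0.
have dZ j : is_derive t 1 (residual_coord j) (b (y1 t) 0 j - b (y2 t) 0 j).
  have -> : residual_coord j = drift_primitive j - ((fun s => corrected s 0 j) - cst (x 0 j)) by [].
  rewrite -[b (y2 t) 0 j]subr0.
  exact: is_deriveB.
have dE : is_derive t 1 (expR \o ( *%R l)) (expR (l * t) * l).
  by apply: is_derive1_comp; rewrite -[X in is_derive _ _ _ X]mulr1;
     apply: (@is_deriveZ _ _ _ id).
have dS : is_derive t 1 (\sum_j (residual_coord j ^+ 2))
    (\sum_j (2%:R * residual_coord j t ^+ 1) *: (b (y1 t) 0 j - b (y2 t) 0 j)).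
  by apply: is_derive_sum => j; exact: is_deriveX.
have dG' : is_derive t 1 gap_primitive (expR (l * t) * dot (gap t) (gap t)) by exact: dG.
have dV := is_deriveB (is_deriveM dE dS) (is_deriveZ C dG').
eexists; first exact: dV.
rewrite fct_sumE.
have -> : \sum_j (2%:R * residual_coord j t ^+ 1) *: (b (y1 t) 0 j - b (y2 t) 0 j) =
    2 * dot (residual t) (b (y1 t) - b (y2 t)).
  rewrite mulr_sumr; apply: eq_bigr => j _.
  rewrite residual_coordE ?(ltW t0) // expr1 mulrA; congr (_ * _); by rewrite !mxE.
have -> : \sum_j (residual_coord j ^+ 2) t = dot (residual t) (residual t).
  by apply: eq_bigr => j _; rewrite residual_coordE ?(ltW t0) // -expr2.
have := drift_estimate (y2 t) (gap t *m S^T) (residual t).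
have -> : y2 t + gap t *m S^T + residual t = y1 t.
  by rewrite [LHS]addrC /residual -[_ - _ - _]addrA -opprD subrK.
move=> h.
rewrite [X in X <= _](_ : _ = expR (l * t) * (2 * dot (residual t) (b (y1 t) - b (y2 t)) +
   l * dot (residual t) (residual t) - C * dot (gap t) (gap t))); last first.
  by rewrite /= /GRing.scale /=; ring.
rewrite pmulr_rle0 ?expR_gt0 //.
have : L * dot (gap t *m S^T) (gap t *m S^T) / l <= C * dot (gap t) (gap t).
  have -> : C * dot (gap t) (gap t) = L * (K * dot (gap t) (gap t)) / l by rewrite /C; ring.
  by rewrite ler_pM2r ?invr_gt0 // ler_wpM2l // S_bounded.
lra.
Qed.

(** Variation of constants: the energy vanishes at 0 and decreases on each smooth
    piece of w2. *)
Lemma pathwise_sqr_le t : 0 <= t ->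
  dot (residual t) (residual t) <=
    C * \int[mu]_(s in `[0, t]) (expR (- (l * (t - s))) * dot (gap s) (gap s)).
Proof.
move=> t0; have [tau [g [tau0 tauS tauoo gs wg]]] := w2s.
have : energy t <= energy 0.
  apply: (grid_nonincreasing tau0 tauS tauoo) => //; first exact: energy_within.
  move=> n s sn; have /andP[ns sn'] := sn; apply: energy_derive_le0.
    exact: le_lt_trans (grid_ge0 tau0 tauS n) ns.
  apply: (@near_eq_derivable _ _ _ (g n)); last exact: (gs n 0%N s).
  have : \forall u \near s, u \in `]tau n, tau n.+1[ by apply: near_in_itvoo; rewrite in_itv.
  apply: filterS => u; rewrite in_itv /= => /andP[nu un].
  by apply/esym/wg; rewrite !ltW.
rewrite energy_at0 energyE // subr_le0 => h.
have -> : \int[mu]_(s in `[0, t]) (expR (- (l * (t - s))) * dot (gap s) (gap s)) =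
    expR (- (l * t)) * gap_primitive t.
  rewrite -RintegralZl //; last first.
    exact (@within_integrable _ _ t (@weighted_gap_within _ expR_scale_continuous t)).
  apply: eq_Rintegral => s _; rewrite mulrA -expRD; congr (expR _ * _); ring.
rewrite mulrCA -(ler_pM2l (expR_gt0 (l * t))) !mulrA -expRD subrr expR0 mul1r.
exact: h.
Qed.

End Pathwise.

(** * Upper integrals and exponentially weighted time averages *)

Section UpperIntegral.
Context {d : measure_display} {T : measurableType d} {R : realType}.
Variable mu : {measure set T -> \bar R}.
Import HBNNSimple.

(** The integral of a nonnegative function is the supremum of the integrals of the
    simple functions below it, which makes sense for a nonmeasurable f as well;
    each of these simple functions is below g almost everywhere. *)
Lemma ae_ge0_le_integral_nonmeasurable (f g : T -> \bar R) :
  (forall w, 0 <= f w)%E -> (forall w, 0 <= g w)%E -> measurable_fun setT g ->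
  {ae mu, forall w, (f w <= g w)%E} ->
  (\int[mu]_w f w <= \int[mu]_w g w)%E.
Proof.
move=> f0 g0 mg fg; rewrite [leLHS]ge0_integralTE //.
apply: ge_ereal_sup => _ [h hf <-].
rewrite -integralT_nnsfun.
apply: ae_ge0_le_integral => //.
- by move=> w _; rewrite lee_fin.
- exact/measurable_EFinP.
- by apply: filterS fg => w fgw _; exact: le_trans (hf w) fgw.
Qed.

End UpperIntegral.

Section IntegrableEFin.
Context {d : measure_display} {T : measurableType d} {R : realType}.
Variable m : {measure set T -> \bar R}.

Lemma integrableZ_EFin (D : set T) (k : R) (f : T -> R) : measurable D ->
  m.-integrable D (EFin \o f) -> m.-integrable D (EFin \o (fun s => k * f s)).
Proof. by move=> mD fi; have := integrableZl mD k fi. Qed.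

Lemma integrableB_EFin (D : set T) (f g : T -> R) : measurable D ->
  m.-integrable D (EFin \o f) -> m.-integrable D (EFin \o g) ->
  m.-integrable D (EFin \o (fun s => f s - g s)).
Proof. by move=> mD fi gi; have := integrableB mD fi gi. Qed.

End IntegrableEFin.

Section Weight.
Context {R : realType}.
Notation mu := lebesgue_measure.
Variables (l : R).
Hypothesis l0 : 0 < l.

Lemma weight_continuous (t : R) : continuous (fun s : R => expR (- (l * (t - s)))).
Proof.
move=> s; apply: (@continuous_comp _ _ _ (fun s : R => - (l * (t - s))) expR).
  apply: cvgN; apply: cvgM; first exact: cvg_cst.
  by apply: cvgB; [exact: cvg_cst|exact: cvg_id].
exact: continuous_expR.
Qed.

(** The weight is the derivative in s of exp(- l (t - s)) / l, which increases from a
    positive value at s = 0 to 1/l at s = t. *)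
Lemma weight_mass (t : R) : 0 <= t ->
  \int[mu]_(s in `[0, t]) expR (- (l * (t - s))) <= l^-1.
Proof.
move=> t0.
pose I (u : R) := \int[mu]_(s in `[0, u]) expR (- (l * (t - s))).
pose E (u : R) := expR (- (l * (t - u))).
have cE T : {within `[0, T], continuous E}.
  by apply: continuous_subspaceT; exact: weight_continuous.
pose H := I - l^-1 *: E.
have dH (u : R) : 0 < u -> is_derive u 1 H 0.
  move=> u0; have dI : is_derive u 1 I (E u) := is_derive_primitive cE u0.
  have dE : is_derive u 1 E (E u * l).
    apply: is_derive1_comp.
    rewrite (_ : (fun s : R => _) = l *: (id : R -> R) - cst (l * t)); last first.
      by apply/funext => s /=; rewrite -[RHS]/(l * s - l * t); ring.
    rewrite -[X in is_derive _ _ _ X]subr0; apply: is_deriveB.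
    rewrite -[X in is_derive _ _ _ X]mulr1; exact: is_deriveZ.
  have -> : (0 : R) = E u - l^-1 *: (E u * l).
    by rewrite /GRing.scale /= mulrCA mulVf ?gt_eqF // mulr1 subrr.
  exact: is_deriveB.
have cH : {within `[0, t], continuous H}.
  move=> u; apply: cvgB; first exact (@within_primitive_continuous _ E cE t u).
  by apply: cvgZr; exact (cE t u).
have : H t <= H 0.
  apply: (@ler0_derive1_le_cc _ H 0 t) => //.
  - by move=> u; rewrite in_itv /= => /andP[/dH []].
  - by move=> u; rewrite in_itv /= => /andP[/dH [? e] _]; rewrite derive1E e.
  - by rewrite in_itv /= lexx t0.
  - by rewrite in_itv /= lexx t0.
rewrite -[H t]/(I t - l^-1 * E t) -[H 0]/(I 0 - l^-1 * E 0).
have -> : I 0 = 0 by rewrite /I set_itv1 Rintegral_set1.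
have Et : E t = 1 by rewrite /E subrr mulr0 oppr0 expR0.
have E0 : 0 <= l^-1 * E 0 by rewrite mulr_ge0 ?expR_ge0 // invr_ge0 ltW.
by rewrite Et mulr1 -/(I t); lra.
Qed.

(** The graph of y |-> y^(m+1) lies above its tangent at k. *)
Lemma tangent_power (m : nat) (y k : R) : 0 <= y -> 0 <= k ->
  k ^+ m * (m.+1%:R * y - m%:R * k) <= y ^+ m.+1.
Proof.
move=> y0 k0; elim: m => [|m IH]; first by rewrite expr0 mul1r mul1r mul0r subr0 expr1.
rewrite [leRHS]exprS; apply: le_trans (ler_wpM2l y0 IH).
rewrite -subr_ge0.
have -> : y * (k ^+ m * (m.+1%:R * y - m%:R * k)) -
    k ^+ m.+1 * (m.+2%:R * y - m.+1%:R * k) = k ^+ m * (m.+1%:R * (y - k) ^+ 2).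
  by rewrite exprS -!natr1; ring.
apply: mulr_ge0; first exact: exprn_ge0.
by apply: mulr_ge0; [exact: ler0n|exact: sqr_ge0].
Qed.

(** Jensen's inequality for a measure of mass at most 1/l rather than a probability:
    the tangent at k = l A, where A is the weighted integral of f, is integrated
    against the weight. *)
Lemma weight_jensen (m : nat) (f : R -> R) (t : R) : 0 <= t ->
  (forall s, 0 <= f s) -> {within `[0, t], continuous f} ->
  (\int[mu]_(s in `[0, t]) (expR (- (l * (t - s))) * f s)) ^+ m.+1 <=
  l^-1 ^+ m * \int[mu]_(s in `[0, t]) (expR (- (l * (t - s))) * f s ^+ m.+1).
Proof.
move=> t0 f0 cf; set w := fun s => expR (- (l * (t - s))).
have cw : {within `[0, t], continuous w}.
  by apply: continuous_subspaceT; exact: weight_continuous.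
set A := \int[mu]_(s in _) _; set B := \int[mu]_(s in _) _.
have iw := within_integrable cw.
have if_ : mu.-integrable `[0, t] (EFin \o (fun s => w s * f s)).
  apply: within_integrable => s; apply: cvgM; [exact (cw s)|exact (cf s)].
have ifm : mu.-integrable `[0, t] (EFin \o (fun s => w s * f s ^+ m.+1)).
  apply: within_integrable => s; apply: cvgM; first exact (cw s).
  by apply: (@continuous_comp (subspace `[0, t]%classic) _ _ f (fun x => x ^+ m.+1));
    [exact (cf s)|exact: exprn_continuous].
have A0 : 0 <= A by apply: Rintegral_ge0 => s _; rewrite mulr_ge0 ?expR_ge0.
pose k := l * A.
have k0 : 0 <= k by rewrite mulr_ge0 // ltW.
have iA : mu.-integrable `[0, t] (EFin \o (fun s => m.+1%:R * (w s * f s))).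
  exact: integrableZ_EFin.
have iW : mu.-integrable `[0, t] (EFin \o (fun s => m%:R * k * w s)).
  exact: integrableZ_EFin.
have iAW : mu.-integrable `[0, t]
    (EFin \o (fun s => m.+1%:R * (w s * f s) - m%:R * k * w s)).
  exact: integrableB_EFin.
have AB : k ^+ m * (m.+1%:R * A - m%:R * k * \int[mu]_(s in `[0, t]) w s) <= B.
  rewrite -RintegralZl // -RintegralZl // -RintegralB // -RintegralZl //.
  apply: le_Rintegral => //; first exact: integrableZ_EFin.
  move=> s _; have := tangent_power m (f0 s) k0.
  move/(ler_wpM2l (expR_ge0 (- (l * (t - s))))) => h.
  by apply: le_trans h; rewrite le_eqVlt; apply/orP; left; apply/eqP; rewrite /w; ring.
have W := weight_mass t0; rewrite -/(w _) in W.
have kW : k * \int[mu]_(s in `[0, t]) w s <= A.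
  apply: le_trans (ler_wpM2l k0 W) _.
  by rewrite /k mulrAC mulfV ?gt_eqF // mul1r.
have : k ^+ m * A <= B.
  apply: le_trans AB; apply: ler_wpM2l; first exact: exprn_ge0.
  rewrite -mulrA -natr1.
  have : m%:R * (k * \int[mu]_(s in `[0, t]) w s) <= m%:R * A by exact: ler_wpM2l.
  by rewrite mulrDl mul1r; lra.
move=> h; rewrite exprVn mulrC ler_pdivlMr ?exprn_gt0 //.
by rewrite exprSr mulrAC -exprMn (mulrC A).
Qed.

End Weight.

(** * Joint measurability and the exchange of time and expectation *)

Section JointMeasurability.
Context {R : realType} {d : measure_display} {T : measurableType d}.

Lemma measurable_countable_select d1 (S : measurableType d1) (h : S -> nat)
    (f : nat -> T -> R) :
  (forall i, measurable (h @^-1` [set i])) ->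
  (forall i, measurable_fun setT (f i)) ->
  measurable_fun setT (fun z : S * T => f (h z.1) z.2).
Proof.
move=> mh mf _ Y mY; rewrite setTI.
rewrite (_ : _ @^-1` _ = \bigcup_i ((h @^-1` [set i]) `*` (f i @^-1` Y))).
  apply: bigcup_measurable => i _; apply: measurableX => //.
  by rewrite -[X in measurable X]setTI; exact: mf.
apply/seteqP; split => [[s w] /= Yf|[s w] /= [i _ [/= <-]]] //.
by exists (h s).
Qed.

(** Discretised absolute time: rounding |s| down keeps the times in the interval
    where the process lives, also for s < 0. *)
Definition round_time (k : nat) (s : R) : R := (Num.truncn (`|s| * k.+1%:R))%:R / k.+1%:R.

Lemma round_time_bounds k s : 0 <= round_time k s <= `|s|.
Proof.
rewrite /round_time divr_ge0 //= ler_pdivrMr //.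
have : 0 <= `|s| * k.+1%:R by rewrite mulr_ge0.
by move/truncn_itv => /andP[].
Qed.

Lemma round_time_dist k s : `| `|s| - round_time k s| <= k.+1%:R^-1.
Proof.
have /andP[_ h] := round_time_bounds k s.
rewrite ger0_norm ?subr_ge0 // lerBlDr -(ler_pM2r (ltr0Sn R k)) mulrDl mulVf //.
rewrite /round_time divfK // ltW // addrC natr1.
have : 0 <= `|s| * k.+1%:R by rewrite mulr_ge0.
by move/truncn_itv => /andP[].
Qed.

Lemma round_time_cvg (s : R) : round_time k s @[k --> \oo] --> `|s|.
Proof.
apply/cvgrPdist_le => e e0.
have := @cvg_harmonic R => /cvgrPdist_le /(_ e e0).
apply: filterS => k; rewrite sub0r normrN ger0_norm ?invr_ge0 //.
exact: le_trans (round_time_dist k s).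
Qed.

Lemma measurable_truncn_preimage (c : R) (i : nat) : 0 <= c ->
  measurable ((fun s : measurableTypeR R => Num.truncn (`|s| * c)) @^-1` [set i]).
Proof.
move=> c0.
have mg : measurable_fun setT (fun s : measurableTypeR R => `|s| * c).
  by apply: measurable_funM => //; exact: normr_measurable.
rewrite (_ : _ @^-1` _ = (fun s : measurableTypeR R => `|s| * c) @^-1` `[i%:R, i.+1%:R[%classic).
  by rewrite -[X in measurable X]setTI; apply: mg => //; exact: measurable_itv.
apply/seteqP; split => s /=; rewrite in_itv /= -truncn_eq ?mulr_ge0 //.
  by move=> ->.
by move/eqP.
Qed.

(** The process is the limit of its samples on finer and finer grids, and each
    sample uses countably many times only. *)
Lemma jointly_measurable_of_continuous (q : R -> T -> R) :
  (forall t, 0 <= t -> measurable_fun setT (q t)) ->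
  (forall w A, {within `[0, A], continuous (q ^~ w)}) ->
  measurable_fun setT (fun z : measurableTypeR R * T => q `|z.1| z.2).
Proof.
move=> mq cq.
apply: (@measurable_fun_cvg _ _ _ _ (fun k z => q (round_time k z.1) z.2)).
  move=> k.
  have := @measurable_countable_select _ (measurableTypeR R)
    (fun s : R => Num.truncn (`|s| * k.+1%:R)) (fun i => q (i%:R / k.+1%:R)).
  apply.
    by move=> i; exact: measurable_truncn_preimage.
  by move=> i; apply: mq; rewrite divr_ge0.
move=> [s w] _ /=.
have /subspace_continuousP /(_ `|s|) := cq w `|s|.
rewrite /= in_itv /= normr_ge0 lexx => /(_ isT) cs.
apply: cvg_trans cs.
move=> P /= sP; have gP : \forall k \near \oo,
    round_time k s \in `[0, `|s|]%R -> P (q (round_time k s) w).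
  exact: (@round_time_cvg s _ sP).
suff : \forall k \near \oo, P (q (round_time k s) w) by [].
by apply: filterS gP => k; apply; rewrite in_itv /= round_time_bounds.
Qed.

End JointMeasurability.

Section TimeAverage.
Context {R : realType} {d : measure_display} {T : measurableType d}.
Variables (P : probability T R) (l : R).
Hypothesis l0 : 0 < l.
Notation mu := (@lebesgue_measure R).

(** The weighted time average is dominated by a function H that is measurable,
    which the time average itself is only up to a null set: the process is
    replaced by 0 outside a measurable set of full measure on which its paths are
    continuous, and H is the inner integral in Tonelli's theorem. *)
Lemma time_average_expectation (q : R -> T -> R) (M t : R) :
  0 <= M ->
  (forall s w, 0 <= q s w) ->
  (forall s, 0 <= s -> measurable_fun setT (q s)) ->
  {ae P, forall w, forall A, {within `[0, A], continuous (q ^~ w)}} ->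
  (forall s, 0 <= s -> (\int[P]_w (q s w)%:E <= M%:E)%E) ->
  0 <= t ->
  exists H : T -> \bar R,
    [/\ measurable_fun setT H, forall w, (0 <= H w)%E,
        {ae P, forall w, ((\int[mu]_(s in `[0, t])
           (expR (- (l * (t - s))) * q s w))%:E <= H w)%E} &
        (\int[P]_w H w <= (M / l)%:E)%E].
Proof.
move=> M0 q0 mq [N [mN PN0 subN]] qM t0.
pose q' s w := q s w * \1_(~` N) w.
have q'0 s w : 0 <= q' s w by rewrite mulr_ge0.
have mq' s : 0 <= s -> measurable_fun setT (q' s).
  by move=> s0; apply: measurable_funM; [exact: mq|apply: measurable_indic; exact: measurableC].
have cq' w A : {within `[0, A], continuous (q' ^~ w)}.
  have [Nw|Nw] := pselect (N w).
    rewrite (_ : q' ^~ w = cst 0); first by apply: continuous_subspaceT => x; exact: cvg_cst.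
    by apply/funext => s; rewrite /q' indicE memNset ?mulr0 //; apply.
  rewrite (_ : q' ^~ w = q ^~ w).
    have : ~ ~ (forall A, {within `[0, A], continuous (q ^~ w)}) by move=> /subN.
    by move/contrapT; apply.
  by apply/funext => s; rewrite /q' indicE mem_set ?mulr1.
have mj := jointly_measurable_of_continuous mq' cq'.
pose wt (s : R) := \1_(`[0, t]%classic) s * expR (- (l * (t - s))).
have wt0 s : 0 <= wt s by rewrite mulr_ge0 ?expR_ge0.
have mwt : measurable_fun setT (wt : measurableTypeR R -> R).
  apply: measurable_funM; first by apply: measurable_indic; exact: measurable_itv.
  by apply: continuous_measurable_fun; exact: weight_continuous.
pose f (z : measurableTypeR R * T) : \bar R := (wt z.1 * q' `|z.1| z.2)%:E.
have f0 z : (0 <= f z)%E by rewrite lee_fin mulr_ge0.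
have mf : measurable_fun setT f.
  apply/measurable_EFinP; apply: measurable_funM => //.
  exact: measurableT_comp.
have mH : measurable_fun setT (fubini_G mu f).
  exact: (@measurable_fun_fubini_tonelli_G _ _ _ _ _ mu _ mf f0).
exists (fubini_G mu f); split.
- exact: mH.
- by move=> w; apply: integral_ge0 => s _.
- exists N; split => // w nw; apply: contrapT => Nw; apply: nw => /=.
  have cqw : {within `[0, t], continuous (q ^~ w)}.
    by move/contrapT: (contra_not (@subN w) Nw); apply.
  have iq : mu.-integrable `[0, t] (EFin \o (fun s => expR (- (l * (t - s))) * q s w)).
    apply: within_integrable => s; apply: cvgM; last exact (cqw s).
    exact (@continuous_subspaceT _ _ `[0, t]%classic _ (@weight_continuous _ l t) s).
  rewrite /Rintegral fineK; last exact: integrable_fin_num.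
  rewrite integral_mkcond /fubini_G le_eqVlt; apply/orP; left; apply/eqP.
  apply: eq_integral => s _; rewrite /f /wt /= patchE.
  case: ifPn => st; last by rewrite indicE (negbTE st) !mul0r.
  rewrite /q' indicE st mul1r indicE mem_set // mulr1.
  by move: st; rewrite inE /= in_itv /= => /andP[s0 _]; rewrite ger0_norm.
rewrite -(@fubini_tonelli _ _ _ _ _ mu P f mf f0).
have iw : mu.-integrable `[0, t] (EFin \o (fun s => expR (- (l * (t - s))))).
  by apply: within_integrable; apply: continuous_subspaceT; exact: weight_continuous.
apply: (@le_trans _ _ (\int[mu]_s ((wt s)%:E * M%:E))%E).
  apply: ge0_le_integral => //.
  - by move=> s _; apply: integral_ge0.
  - exact: (@measurable_fun_fubini_tonelli_F _ _ _ _ _ P _ mf f0).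
  - by apply: emeasurable_funM => //; exact/measurable_EFinP.
  move=> s _; rewrite /f /=.
  under eq_integral do rewrite EFinM.
  rewrite ge0_integralZl //.
  - apply: lee_wpmul2l; first by rewrite lee_fin.
    apply: (@le_trans _ _ (\int[P]_w (q `|s| w)%:E)%E); last exact: qM.
    apply: ge0_le_integral => //.
    + by move=> w _; rewrite lee_fin.
    + by apply/measurable_EFinP; exact: mq'.
    + by apply/measurable_EFinP; exact: mq.
    by move=> w _; rewrite lee_fin /q' indicE; case: (_ \in _); rewrite ?mulr1 ?mulr0.
  - by apply/measurable_EFinP; exact: mq'.
  - by move=> w _; rewrite lee_fin.
  - by rewrite lee_fin.
rewrite ge0_integralZr //; last 2 first.
- exact/measurable_EFinP.
- by move=> s _; rewrite lee_fin.
have -> : (\int[mu]_s (wt s)%:E = (\int[mu]_(s in `[0%R, t]) expR (- (l * (t - s))))%:E)%E.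
  rewrite /Rintegral fineK; last exact: integrable_fin_num.
  rewrite integral_mkcond; apply: eq_integral => s _; rewrite patchE /wt indicE.
  by case: (_ \in _); rewrite ?mul1r ?mul0r.
rewrite -EFinM lee_fin mulrC; apply: ler_wpM2l => //.
exact: weight_mass.
Qed.

End TimeAverage.

(** * From even moments to all moments *)

Section Moments.
Context {R : realType}.

(** If x <= k, then x^p <= k^p; otherwise (x/k)^p <= (x/k)^n. *)
Lemma powR_le_moment (x k p : R) (n : nat) : 0 <= x -> 0 < k -> 0 <= p -> p <= n%:R ->
  x `^ p <= k `^ p * (1 + (x / k) ^+ n).
Proof.
move=> x0 k0 p0 pn; have kp : 0 <= k `^ p by exact: powR_ge0.
have xk0 : 0 <= x / k by rewrite divr_ge0 // ltW.
have [xk|kx] := leP x k.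
  apply: (@le_trans _ _ (k `^ p)); first by apply: ge0_ler_powR => //; rewrite nnegrE // ltW.
  by rewrite ler_peMr // lerDl exprn_ge0.
rewrite -{1}(divfK (lt0r_neq0 k0) x) mulrC powRM //; last exact: ltW.
apply: ler_wpM2l => //; apply: (@le_trans _ _ ((x / k) ^+ n)); last by rewrite lerDr.
rewrite -powR_mulrn //; apply: ler_powR => //.
by rewrite ler_pdivlMr // mul1r ltW.
Qed.

Lemma exprD_le (a b : R) (n : nat) : 0 <= a -> 0 <= b ->
  (a + b) ^+ n <= 2 ^+ n * (a ^+ n + b ^+ n).
Proof.
move=> a0 b0; wlog ab : a b a0 b0 / a <= b.
  move=> H; have [ab|/ltW ba] := leP a b; first exact: H.
  by rewrite addrC [a ^+ n + _]addrC; exact: H.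
apply: (@le_trans _ _ ((2 * b) ^+ n)).
  by apply: lerXn2r; rewrite ?nnegrE ?addr_ge0 ?mulr_ge0 //; lra.
rewrite exprMn; apply: ler_wpM2l; first exact: exprn_ge0.
by rewrite lerDr exprn_ge0.
Qed.

Context {d : measure_display} {T : measurableType d}.
Variables (P : probability T R) (l : R).
Hypothesis l0 : 0 < l.
Notation mu := (@lebesgue_measure R).

(** With n = m + 1: the first 1 comes from u^p <= k^p (1 + (u/k)^(2n)), the factor
    2 from (a + b)^(2n) <= 2^(2n) (a^(2n) + b^(2n)), the 1 in the last factor from
    the gap at time t, and l^(-n) from Jensen's inequality and the mass of the
    weight. *)
Definition moment_constant (c A : R) (m : nat) : R :=
  1 + (2 * c * A) ^+ (2 * m.+1) * (1 + l^-1 ^+ m.+1).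

(** U stands for a supremum over uncountably many starting points, which may fail
    to be measurable; its moment is bounded through a measurable majorant G of
    U^p. *)
Lemma Lp_of_time_average (Q : R -> T -> R) (U : T -> \bar R) (c k A p t : R) (m : nat) :
  (forall s w, 0 <= Q s w) ->
  (forall s, 0 <= s -> measurable_fun setT (Q s)) ->
  {ae P, forall w, forall T, {within `[0, T], continuous (Q ^~ w)}} ->
  (forall s, 0 <= s ->
     (\int[P]_w (Q s w ^+ m.+1)%:E <= ((A * k) ^+ (2 * m.+1))%:E)%E) ->
  (forall w, 0 <= U w)%E ->
  {ae P, forall w, (U w <= (c * (Num.sqrt (Q t w) +
     Num.sqrt (\int[mu]_(s in `[0, t]) (expR (- (l * (t - s))) * Q s w))))%:E)%E} ->
  0 <= c -> 0 < k -> 1 <= p -> p <= (2 * m.+1)%:R -> 0 <= t ->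
  ('N[P]_(p%:E)[U] <= (moment_constant c A m `^ p^-1 * k)%:E)%E.
Proof.
move=> Q0 mQ cQ EQ U0 UQ c0 k0 p1 pn t0; set n := (2 * m.+1)%N.
have p0 : 0 < p by exact: lt_le_trans ltr01 p1.
have M0 : 0 <= (A * k) ^+ n by rewrite /n exprM exprn_ge0 // sqr_ge0.
have cQn : {ae P, forall w, forall T, {within `[0, T], continuous (fun s => Q s w ^+ m.+1)}}.
  apply: filterS cQ => w cw T' s.
  by apply: (@continuous_comp (subspace `[0, T']%classic) _ _ (Q ^~ w) (fun x => x ^+ m.+1));
    [exact (cw T' s)|exact: exprn_continuous].
have mQn s : 0 <= s -> measurable_fun setT (fun w => Q s w ^+ m.+1).
  by move=> s0; apply: measurable_funX; exact: mQ.
have [H [mH H0 HI EH]] := time_average_expectation l0 M0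
  (fun s w => exprn_ge0 m.+1 (Q0 s w)) mQn cQn EQ t0.
pose kp := k `^ p.
have kp0 : 0 <= kp by exact: powR_ge0.
pose k1 := kp * (2 * c / k) ^+ n.
have k10 : 0 <= k1 by rewrite mulr_ge0 // exprn_ge0 // divr_ge0 ?mulr_ge0 // ltW.
pose k2 := k1 * l^-1 ^+ m.
have k20 : 0 <= k2 by rewrite mulr_ge0 // exprn_ge0 // invr_ge0 ltW.
pose G w := (kp%:E + (k1%:E * (Q t w ^+ m.+1)%:E + k2%:E * H w))%E.
have mQt : measurable_fun setT (fun w => k1%:E * (Q t w ^+ m.+1)%:E)%E.
  by apply: emeasurable_funM => //; apply/measurable_EFinP; exact: mQn.
have mHk : measurable_fun setT (fun w => k2%:E * H w)%E by exact: emeasurable_funM.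
have Qt0 w : (0 <= k1%:E * (Q t w ^+ m.+1)%:E)%E by rewrite mule_ge0 ?lee_fin ?exprn_ge0.
have Hk0 w : (0 <= k2%:E * H w)%E by rewrite mule_ge0 ?lee_fin.
have UG : {ae P, forall w, (`|U w| `^ p <= G w)%E}.
  apply: filterS3 UQ HI cQ => w Uw Iw cw.
  rewrite gee0_abs //.
  set a := Num.sqrt (Q t w) in Uw; set I := \int[mu]_(s in _) _ in Uw.
  have I0 : 0 <= I by apply: Rintegral_ge0 => s _; rewrite mulr_ge0 ?expR_ge0.
  have x0 : 0 <= c * (a + Num.sqrt I) by rewrite mulr_ge0 // addr_ge0 ?sqrtr_ge0.
  apply: (@le_trans _ _ ((c * (a + Num.sqrt I))%:E `^ p)%E).
    by apply: gt0_ler_poweR; rewrite ?(ltW p0) // ?in_itv /= ?leey ?andbT // lee_fin.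
  rewrite poweR_EFin; apply: (@le_trans _ _
     (kp + (k1 * Q t w ^+ m.+1 + k2 * \int[mu]_(s in `[0, t])
           (expR (- (l * (t - s))) * Q s w ^+ m.+1)))%:E).
    rewrite lee_fin; apply: le_trans (powR_le_moment x0 k0 (ltW p0) pn) _.
    set J := \int[mu]_(s in _) _.
    have IJ : I ^+ m.+1 <= l^-1 ^+ m * J.
      by apply: (weight_jensen l0) => //; exact: cw.
    have ab : (c * (a + Num.sqrt I) / k) ^+ n <=
        (2 * c / k) ^+ n * (Q t w ^+ m.+1 + l^-1 ^+ m * J).
      have -> : c * (a + Num.sqrt I) / k = (c / k) * (a + Num.sqrt I) by rewrite mulrAC.
      have -> : 2 * c / k = 2 * (c / k) by rewrite mulrA.
      rewrite exprMn [(2 * _) ^+ n]exprMn (mulrC (2 ^+ n)) -mulrA.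
      apply: ler_wpM2l; first by rewrite exprn_ge0 // divr_ge0 // ltW.
      apply: le_trans (exprD_le n (sqrtr_ge0 _) (sqrtr_ge0 _)) _.
      apply: ler_wpM2l; first exact: exprn_ge0.
      by rewrite /n !exprM !sqr_sqrtr // lerD2l.
    rewrite -/kp; apply: le_trans (ler_wpM2l kp0 (lerD (lexx 1) ab)) _.
    by rewrite le_eqVlt; apply/orP; left; apply/eqP; rewrite /k2 /k1; ring.
  rewrite /G !EFinD !EFinM; apply: leeD => //; apply: leeD => //.
  by apply: lee_wpmul2l => //; rewrite lee_fin.
have G0 w : (0 <= G w)%E by rewrite /G !adde_ge0 // lee_fin.
have mG : measurable_fun setT G.
  by apply: emeasurable_funD => //; exact: emeasurable_funD.
have EG : (\int[P]_w G w <= (kp * moment_constant c A m)%:E)%E.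
  rewrite /G ge0_integralD //; last 2 first.
  - by move=> w _; rewrite adde_ge0.
  - exact: emeasurable_funD.
  rewrite integral_cst // [X in (_ * X)%E]probability_setT mule1.
  rewrite ge0_integralD // ge0_integralZl //; last 2 first.
  - by apply/measurable_EFinP; exact: mQn.
  - by move=> w _; rewrite lee_fin exprn_ge0.
  rewrite ge0_integralZl //.
  apply: (@le_trans _ _ (kp%:E + (k1%:E * ((A * k) ^+ n)%:E + k2%:E * ((A * k) ^+ n / l)%:E))%E).
    by apply: leeD => //; apply: leeD; apply: lee_wpmul2l => //; exact: EQ.
  rewrite -!EFinM -!EFinD lee_fin le_eqVlt; apply/orP; left; apply/eqP.
  rewrite /k2 /k1 /moment_constant -/n.
  have kA : (2 * c / k) ^+ n * (A * k) ^+ n = (2 * c * A) ^+ n.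
    rewrite -exprMn; congr (_ ^+ n); field; exact: lt0r_neq0.
  rewrite -kA exprSr; ring.
have K0 : 0 <= moment_constant c A m.
  rewrite addr_ge0 // mulr_ge0 //; first by rewrite exprM exprn_ge0 // sqr_ge0.
  by rewrite addr_ge0 // exprn_ge0 // invr_ge0 ltW.
rewrite unlock; apply: (@le_trans _ _ ((kp * moment_constant c A m)%:E `^ p^-1)%E).
  apply: gt0_ler_poweR; rewrite ?invr_ge0 ?(ltW p0) // ?in_itv /= ?leey ?andbT.
  - by apply: integral_ge0 => w _; exact: poweR_ge0.
  - by rewrite lee_fin mulr_ge0.
  - apply: le_trans EG; apply: ae_ge0_le_integral_nonmeasurable => //.
    by move=> w; exact: poweR_ge0.
rewrite poweR_EFin lee_fin powRM // /kp -powRrM mulfV ?gt_eqF // powRr1; last exact: ltW.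
by rewrite mulrC.
Qed.

End Moments.

(** * The uniform estimates for the flows *)

Section FlowDistance.
Context {R : realType} {r : nat}.
Notation mu := lebesgue_measure.

Lemma enormE (v : 'rV[R]_r) : enorm v = Num.sqrt (dot v v).
Proof. by rewrite -enorm_sqr sqrtr_sqr ger0_norm // enorm_ge0. Qed.

Lemma dot_sqr_within (w1 w2 : R -> 'rV[R]_r) (T : R) :
  {within `[0, +oo[, continuous w1} -> piecewise_smooth w2 ->
  {within `[0, T], continuous (fun s => dot (w1 s - w2 s) (w1 s - w2 s))}.
Proof.
move=> c1 c2.
rewrite (_ : (fun s => _) = (fun s => cst 1 s * dot (w1 s - w2 s) (w1 s - w2 s))); last first.
  by apply/funext => s; rewrite /= mul1r.
by apply: weighted_gap_within => //; exact: cst_continuous.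
Qed.

(** The factor 2 in the condition on c comes from |u + v|^2 <= 2 |u|^2 + 2 |v|^2,
    applied to u the residual and v = S (w1 - w2). *)
Lemma flow_distance_le (b : 'rV[R]_r -> 'rV[R]_r) (S : 'M[R]_r) (l L K c : R)
    (w1 w2 : R -> 'rV[R]_r) (x : 'rV[R]_r) (y1 y2 : R -> 'rV[R]_r) (t : R) :
  0 < l ->
  (forall x h : 'rV[R]_r, dot h (b (x + h) - b x) <= - l * dot h h) ->
  (forall x h : 'rV[R]_r,
     dot (b (x + h) - b x) (b (x + h) - b x) <= L * dot h h) ->
  (forall v : 'rV[R]_r, dot (v *m S^T) (v *m S^T) <= K * dot v v) ->
  0 <= L -> 0 <= K -> (forall j, continuous (component b j)) ->
  w1 0 = 0 -> w2 0 = 0 ->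
  {within `[0, +oo[, continuous w1} -> piecewise_smooth w2 ->
  integral_solution b S w1 x y1 -> ode_solution b S w2 x y2 ->
  0 <= c -> 2 * (L * K / l + K) <= c ^+ 2 -> 0 <= t ->
  enorm (y1 t - y2 t) <= c * (enorm (w1 t - w2 t) +
    Num.sqrt (\int[mu]_(s in `[0, t])
      (expR (- (l * (t - s))) * dot (w1 s - w2 s) (w1 s - w2 s)))).
Proof.
move=> l0 bd bl SK L0 K0 bc w10 w20 w1c w2s y1s y2s c0 cC t0.
have := pathwise_sqr_le l0 bd bl SK L0 bc w10 w20 w1c w2s y1s y2s t0.
set I := \int[mu]_(s in _) _; set D := w1 t - w2 t; set z := y1 t - y2 t - _.
move=> zI.
have I0 : 0 <= I by apply: Rintegral_ge0 => s _; rewrite mulr_ge0 ?expR_ge0 ?dot_ge0.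
have -> : y1 t - y2 t = z + D *m S^T by rewrite /z subrK.
clearbody z.
have h : dot (z + D *m S^T) (z + D *m S^T) <= 2 * (L * K / l * I) + 2 * (K * dot D D).
  have := dot_ge0 (z - D *m S^T); have := SK D; move: zI.
  by rewrite !dotE (dotC _ z); lra.
have s0 : 0 <= enorm D + Num.sqrt I by rewrite addr_ge0 ?enorm_ge0 ?sqrtr_ge0.
rewrite -(ler_pXn2r (isT : (0 < 2)%N)) ?nnegrE ?enorm_ge0 ?mulr_ge0 //.
rewrite enorm_sqr; apply: le_trans h _.
have C0 : 0 <= L * K / l by rewrite divr_ge0 ?mulr_ge0 // ltW.
have D0 := dot_ge0 D.
apply: (@le_trans _ _ (c ^+ 2 * (dot D D + I))).
  apply: (@le_trans _ _ (2 * (L * K / l + K) * (dot D D + I))); last first.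
    by apply: ler_wpM2r => //; rewrite addr_ge0.
  move: (L * K / l) (dot D D) C0 D0 => C D2 C0 D0.
  have : 0 <= C * D2 by rewrite mulr_ge0.
  have : 0 <= K * I by rewrite mulr_ge0.
  lra.
rewrite exprMn; apply: ler_wpM2l; first exact: sqr_ge0.
rewrite sqrrD enorm_sqr sqr_sqrtr // lerD2r lerDl.
by rewrite mulrn_wge0 // mulr_ge0 ?enorm_ge0 ?sqrtr_ge0.
Qed.

End FlowDistance.

Unset Implicit Arguments.

Theorem theorem2p1 (R : realType) (r : nat)
    (b : 'rV[R]_r -> 'rV[R]_r) (Sigma : 'M[R]_r)
    (d : measure_display) (T : measurableType d) (P : probability T R)
    (B : R -> T -> 'rV[R]_r) (X : R -> 'rV[R]_r -> T -> 'rV[R]_r) :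
  (1 <= r)%N ->
  bounded_derivatives12 b ->
  sup [set log_norm (nabla b x) | x in [set: 'rV[R]_r]] < 0 ->
  brownian_motion P B ->
  sde_flow P b Sigma B X ->
  exists lambda c : R, [/\ 0 < lambda, 0 < c &
    forall a : R -> R, exists cp : R -> R,
    forall (eps : R) (Bbar : R -> T -> 'rV[R]_r)
      (Xbar : R -> 'rV[R]_r -> T -> 'rV[R]_r),
    0 < eps ->
    piecewise_smooth_process P Bbar ->
    (forall p : R, 1 <= p ->
      (sup_time_Lp P p (fun t w => (enorm (B t w - Bbar t w))%:E)
        <= (a p * Num.sqrt eps)%:E)%E) ->
    ode_flow P b Sigma Bbar Xbar ->
    (forall t : R, 0 <= t ->
      {ae P, forall w,
        (uniform_dist (X t) (Xbar t) w <=
          (c * (enorm (B t w - Bbar t w) +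
                Num.sqrt (\int[lebesgue_measure]_(s in `[0, t])
                  (expR (- (2 * lambda * (t - s))) *
                   enorm (B s w - Bbar s w) ^+ 2))))%:E)%E}) /\
    (forall p : R, 1 <= p ->
      (sup_time_Lp P p (fun t => uniform_dist (X t) (Xbar t))
        <= (cp p * Num.sqrt eps)%:E)%E)].
Proof.
move=> r1 bD supE [mB B0 cB _ _] [mX sdeX].
set l := - sup [set log_norm (nabla b x) | x in [set: 'rV[R]_r]].
have l0 : 0 < l by rewrite oppr_gt0.
have [L L0 bL] := lipschitz_sqr bD.
have bd (x h : 'rV[R]_r) : dot h (b (x + h) - b x) <= - l * dot h h.
  by rewrite opprK; exact: one_sided_lipschitz.
have bc j : continuous (component b j).
  by move=> x; apply: differentiable_continuous; have [[]] := bD j.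
pose K := \sum_(i < r) \sum_(j < r) (Sigma^T) j i ^+ 2.
have K0 : 0 <= K by apply: sumr_ge0 => i _; apply: sumr_ge0 => j _; exact: sqr_ge0.
have SK v : dot (v *m Sigma^T) (v *m Sigma^T) <= K * dot v v by exact: dot_mulmx_sqr.
pose C := 2 * (L * K / l + K).
have C0 : 0 <= C by rewrite mulr_ge0 // addr_ge0 // divr_ge0 ?mulr_ge0 // ltW.
(* C vanishes when Sigma = 0; the added 1 keeps c positive. *)
pose c := Num.sqrt C + 1.
have c0 : 0 < c by rewrite ltr_wpDl ?sqrtr_ge0.
have cC : C <= c ^+ 2.
  rewrite -{1}(sqr_sqrtr C0); apply: lerXn2r; rewrite ?nnegrE ?sqrtr_ge0 ?(ltW c0) //.
  by rewrite lerDl.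
exists (l / 2), c; split => //; first by rewrite divr_gt0.
move=> a.
exists (fun p => moment_constant l c (a (2 * (Num.truncn p).+1)%:R) (Num.truncn p) `^ p^-1).
move=> eps Bbar Xbar eps0 [mBbar Bbar0 sBbar] err [mXbar odeX].
have -> : 2 * (l / 2) = l by rewrite mulrC divfK.
have ae_bound : {ae P, forall w, forall t, 0 <= t ->
    (uniform_dist (X t) (Xbar t) w <=
      (c * (enorm (B t w - Bbar t w) +
        Num.sqrt (\int[lebesgue_measure]_(s in `[0, t])
          (expR (- (l * (t - s))) *
             dot (B s w - Bbar s w) (B s w - Bbar s w)))))%:E)%E}.
  apply: filterS2 (filterI B0 (filterI cB sdeX)) (filterI Bbar0 (filterI sBbar odeX)).
  move=> w [B0w [cBw Xw]] [Bb0w [sw Xbw]] t t0.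
  apply: ge_ereal_sup => _ [x _ <-]; rewrite lee_fin.
  exact: (flow_distance_le l0 bd bL SK L0 K0 bc B0w Bb0w cBw sw (Xw x) (Xbw x) (ltW c0) cC t0).
have cQ : {ae P, forall w, forall A, {within `[0, A], continuous
    (fun s => dot (B s w - Bbar s w) (B s w - Bbar s w))}}.
  by apply: filterS2 cB sBbar => w cw sw A; exact: dot_sqr_within.
split.
  move=> t t0; apply: filterS ae_bound => w /(_ t t0).
  by under eq_Rintegral do rewrite -enorm_sqr.
move=> p p1; set m := Num.truncn p; set n := (2 * m.+1)%N.
have pm : p < m.+1%:R by have /truncn_itv/andP[] := le_trans ler01 p1.
have pn : p <= n%:R.
  by apply: le_trans (ltW pm) _; rewrite ler_nat /n mul2n -addnn leq_addr.
apply: ge_ereal_sup => _ [t /= t0 <-].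
move: t0; rewrite in_itv /= andbT => t0.
apply: (@Lp_of_time_average _ _ _ P l l0
  (fun s w => dot (B s w - Bbar s w) (B s w - Bbar s w)) _ c (Num.sqrt eps) (a n%:R) p t m) => //.
- by move=> s w; exact: dot_ge0.
- move=> s s0; rewrite /dot; apply: measurable_sum => i.
  have mD : measurable_fun setT (fun w => (B s w - Bbar s w) 0 i).
    rewrite (_ : (fun w => _) = (fun w => B s w 0 i - Bbar s w 0 i)); last first.
      by apply/funext => w; rewrite !mxE.
    by apply: measurable_funB; [exact: mB|exact: mBbar].
  exact: measurable_funM.
- move=> s s0.
  have n1 : 1 <= n%:R :> R by exact: le_trans p1 pn.
  have nn0 : (n%:R : R) != 0 by rewrite gt_eqF // (lt_le_trans ltr01).
  have Nle : ('N[P]_(n%:R%:E)[(fun w => (enorm (B s w - Bbar s w))%:E)] <=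
      (a n%:R * Num.sqrt eps)%:E)%E.
    apply: le_trans (err n%:R n1); apply: ereal_sup_ubound.
    by exists s => //=; rewrite in_itv /= s0.
  have a0 : 0 <= a n%:R * Num.sqrt eps.
    by rewrite -lee_fin; apply: le_trans Nle; exact: Lnorm_ge0.
  have -> : (\int[P]_w (dot (B s w - Bbar s w) (B s w - Bbar s w) ^+ m.+1)%:E =
     'N[P]_(n%:R%:E)[(fun w => (enorm (B s w - Bbar s w))%:E)] `^ n%:R)%E.
    rewrite poweR_Lnorm //; apply: eq_integral => w _.
    rewrite gee0_abs ?lee_fin ?enorm_ge0 // poweR_EFin powR_mulrn ?enorm_ge0 //.
    by rewrite /n exprM enorm_sqr.
  rewrite -powR_mulrn // -poweR_EFin; apply: gt0_ler_poweR => //.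
  - by rewrite in_itv /= Lnorm_ge0 leey.
  - by rewrite in_itv /= lee_fin a0 leey.
- move=> w; apply: (@le_trans _ _ (enorm (X t 0 w - Xbar t 0 w))%:E).
    by rewrite lee_fin enorm_ge0.
  by apply: ereal_sup_ubound; exists 0.
- apply: filterS ae_bound => w wb.
  by rewrite /= -enormE; exact: wb.
- exact: ltW.
- by rewrite sqrtr_gt0.
Qed.
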